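(* Let $n\ge 1$ and $k\ge 1$ be integers and let $(\bar z_0,\bar w_0)=(z_1,\dots,z_n,w_1,\dots,w_n)\in \mathbf{Per}_k\subset\mathbb{R}^{2n}$ be any initial value in the set of quasi-periodic points. Consider its orbit under the pentagram map $T$ (written in the canonical coordinates) and denote $$T^m(\bar z_0,\bar w_0)=(z_1^m,\dots,z_n^m,w_1^m,\dots,w_n^m),$$ where $m$ is an upper index (not a power). Then for every $1\le i\le n$ and for both choices of the sign in the exponent, $$0<\left|\frac{z_i}{z_i^k}\right|^{\pm1}\le 4^{(5^k-1)/4},\qquad 0<\left|\frac{w_i}{w_i^k}\right|^{\pm1}\le 4^{(5^k-1)/4}.$$
   Context: All indices $i$ are taken modulo $n$. Pentagram map in coordinates: a twisted $n$-gon is a map $\phi:\mathbb{Z}\to\mathbb{RP}^2$ with $\phi(j+n)=M(\phi(j))$ for all $j\in\mathbb{Z}$ and some projective automorphism $M$. The space of twisted $n$-gons modulo projective equivalence has generic coordinates $(z_1,\dots,z_n,w_1,\dots,w_n)\in\mathbb{R}^{2n}$ (the canonical cross-ratio coordinates), in which the pentagram map $T$ is the (generically defined) map $(\bar z,\bar w)\mapsto(\bar z',\bar w')$ given by $$z_i'=z_i\,\frac{1-z_{i-1}w_{i-1}}{1-z_{i+1}w_{i+1}},\qquad w_i'=w_{i+1}\,\frac{1-z_{i+2}w_{i+2}}{1-z_iw_i}\qquad(1\le i\le n).$$ Throughout, $T$ means this map on coordinates. Pentagram automaton: the map $\varphi:\mathbb{R}^{2n}\to\mathbb{R}^{2n}$,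 $(\bar x,\bar y)\mapsto(\bar x',\bar y')$, given by $$x_i'=x_i+\max(0,x_{i-1}+y_{i-1})-\max(0,x_{i+1}+y_{i+1}),$$ $$y_i'=y_{i+1}+\max(0,x_{i+2}+y_{i+2})-\max(0,x_i+y_i).$$ Periodic points: $Per_k=\{(\bar x,\bar y)\in\mathbb{R}^{2n}:\varphi^k(\bar x,\bar y)=(\bar x,\bar y)\}$. Let $\widetilde{Per}_k=\bigcup_{t>1}\{(t^{x_1},\dots,t^{x_n},t^{y_1},\dots,t^{y_n}):(x_1,\dots,x_n,y_1,\dots,y_n)\in Per_k\}\subset\mathbb{R}^{2n}_{>0}$. Quasi-periodic points of the pentagram map: $\mathbf{Per}_k\subset\mathbb{R}^{2n}$ is the set of all points of the form $(-a_1,\dots,-a_n,b_1,\dots,b_n)$ or $(a_1,\dots,a_n,-b_1,\dots,-b_n)$ with $(a_1,\dots,a_n,b_1,\dots,b_n)\in\widetilde{Per}_k$. *)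

(* Defs.v *)
From HB Require Import structures.
From mathcomp Require Import all_boot all_order all_algebra.
From mathcomp Require Import classical_sets reals exp.

Set Implicit Arguments.
Unset Strict Implicit.
Unset Printing Implicit Defensive.

Import Order.TTheory GRing.Theory Num.Theory.

Local Open Scope classical_set_scope.
Local Open Scope ring_scope.

(* R^{2n} is split into its two halves (z, w), resp. (x, y).  The index set is
   'I_n, i.e. 0, ..., n-1; [ordS] and [ord_pred] are i + 1 and i - 1 mod n. *)
Notation coords R n := ('rV[R]_n * 'rV[R]_n)%type.

Section Pentagram.
Variables (R : realType) (n : nat).

(* T is only generically defined.  This total function is meaningful only where
   [pentagram_defined] holds, since MathComp sets 0^-1 = 0. *)
Definition pentagram (p : coords R n) : coords R n :=
  let: (z, w) := p in
  let c i := 1 - z 0 i * w 0 i in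
  (\row_i (z 0 i * (c (ord_pred i) / c (ordS i))),
   \row_i (w 0 (ordS i) * (c (ordS (ordS i)) / c i))).

(* All denominators in the formulas for T are nonzero (both denominators have
   the form 1 - z_j w_j, and each j occurs). *)
Definition pentagram_defined (p : coords R n) : Prop :=
  forall i, 1 - p.1 0 i * p.2 0 i != 0.

Definition automaton (p : coords R n) : coords R n :=
  let: (x, y) := p in
  let c i := Num.max 0 (x 0 i + y 0 i) in
  (\row_i (x 0 i + c (ord_pred i) - c (ordS i)),
   \row_i (y 0 (ordS i) + c (ordS (ordS i)) - c i)).

Definition automaton_per (k : nat) : set (coords R n) :=
  [set p | iter k automaton p = p].

Definition exp_point (t : R) (p : coords R n) : coords R n :=
  (map_mx (powR t) p.1, map_mx (powR t) p.2).

Definition exp_per (k : nat) : set (coords R n) :=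
  \bigcup_(t in [set t : R | 1 < t]) (exp_point t @` automaton_per k).

Definition quasi_per (k : nat) : set (coords R n) :=
  [set (- p.1, p.2) | p in exp_per k] `|` [set (p.1, - p.2) | p in exp_per k].

End Pentagram.

(* Main.v *)
(* Compare the T-orbit of p, in absolute value, with t^(automaton orbit).  As
   z_i w_j < 0 for all i, j along the orbit, 1 - z w = 1 + |z||w|, which agrees
   with t^max(0, x + y) = max(1, t^(x + y)) up to a factor 2.  Hence if |z|, |w|
   agree with t^x, t^y up to a factor D, then after one step they do so up to
   D (2 D^2) (2 D^2) = 4 D^5; starting from D = 1 this gives 4^((5^k - 1)/4)
   after k steps, when the automaton is back at its starting point. *)
Require Import Defs.
From HB Require Import structures.
From mathcomp Require Import all_boot all_order all_algebra.
From mathcomp Require Import classical_sets reals exp.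
From mathcomp Require Import ring lra.

Set Implicit Arguments.
Unset Strict Implicit.
Unset Printing Implicit Defensive.

Import Order.TTheory GRing.Theory Num.Theory.

Local Open Scope classical_set_scope.
Local Open Scope ring_scope.

Section WithinFactor.
Variable R : realType.
Implicit Types D E u v : R.

Definition within_factor D u v : Prop :=
  [/\ 0 < u, 0 < v, u <= D * v & v <= D * u].

Lemma within_factorM D E u v u' v' :
  within_factor D u v -> within_factor E u' v' ->
  within_factor (D * E) (u * u') (v * v').
Proof.
move=> [u0 v0 uv vu] [u0' v0' uv' vu']; split; rewrite ?mulr_gt0 // mulrACA.
  by apply: ler_pM => //; exact: ltW.
by apply: ler_pM => //; exact: ltW.
Qed.

Lemma within_factorV D u v : within_factor D u v -> within_factor D u^-1 v^-1.
Proof.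
move=> [u0 v0 uv vu]; split; rewrite ?invr_gt0 //.
  by rewrite ler_pdivlMr // mulrC ler_pdivrMr.
by rewrite ler_pdivlMr // mulrC ler_pdivrMr.
Qed.

(** Both [1] and [u] are at most [D * max 1 v], whence the factor 2; conversely
    [max 1 v <= D * max 1 u <= D * (1 + u)]. *)
Lemma within_factor_add1_max1 D u v : 1 <= D ->
  within_factor D u v -> within_factor (2 * D) (1 + u) (Num.max 1 v).
Proof.
move=> D1 [u0 v0 uv vu]; have [v1|v1] := leP v 1; split => //; nra.
Qed.

End WithinFactor.

Section Tropicalization.
Variables (R : realType) (n : nat) (t : R).
Hypothesis t1 : 1 < t.

Let t0 : t != 0. Proof. by rewrite gt_eqF // (lt_trans ltr01). Qed.

Let powR_gt0_t x : 0 < t `^ x. Proof. by rewrite powR_gt0 // (lt_trans ltr01). Qed.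

Lemma powR_max0 x : t `^ (Num.max 0 x) = Num.max 1 (t `^ x).
Proof.
have [x0|x0] := leP x 0; rewrite -(powRr0 t).
  by rewrite max_l // ler_powR // ltW.
by rewrite max_r // ler_powR // ltW.
Qed.

(** The sign condition ranges over all pairs [i], [j] because a step shifts the index of [w] but not
    that of [z]. It covers both sign patterns of [quasi_per] at once. *)
Definition tracks (D : R) (p q : coords R n) : Prop :=
  [/\ forall i j, p.1 0 i * p.2 0 j < 0,
      forall i, within_factor D `|p.1 0 i| (t `^ (q.1 0 i)) &
      forall i, within_factor D `|p.2 0 i| (t `^ (q.2 0 i))].

(** Since [z_i * w_i < 0], each denominator exceeds 1, so the convention [0^-1 = 0] never
    intervenes. *)
Lemma tracks_pentagram_defined D p q : tracks D p q -> pentagram_defined p.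
Proof. by move=> [neg _ _] i; rewrite gt_eqF //; have := neg i i; lra. Qed.

Lemma tracks_step D p q : 1 <= D -> tracks D p q ->
  tracks (4 * D ^+ 5) (pentagram p) (automaton q).
Proof.
case: p q => [z w] [x y] D1 [/= neg hz hw].
have hc i : within_factor (2 * D ^+ 2) (1 - z 0 i * w 0 i)
    (t `^ (Num.max 0 (x 0 i + y 0 i))).
  rewrite powR_max0 powRD ?t0 ?implybT //.
  have -> : 1 - z 0 i * w 0 i = 1 + `|z 0 i| * `|w 0 i|.
    by rewrite -normrM ltr0_norm.
  by apply: within_factor_add1_max1; [nra | exact: within_factorM].
have c0 i : 0 < 1 - z 0 i * w 0 i by case: (hc i).
(* The formulas for both halves share this shape, so one estimate serves [z] and [w]. *)
have step u v i j : within_factor D `|u| (t `^ v) ->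
    within_factor (4 * D ^+ 5)
     `|u * ((1 - z 0 i * w 0 i) / (1 - z 0 j * w 0 j))|
      (t `^ (v + Num.max 0 (x 0 i + y 0 i) - Num.max 0 (x 0 j + y 0 j))).
  move=> uv; rewrite -addrA normrM [X in `|_| * X]gtr0_norm ?divr_gt0 //.
  rewrite !powRD ?t0 ?implybT // powRN.
  have -> : 4 * D ^+ 5 = D * ((2 * D ^+ 2) * (2 * D ^+ 2)) by ring.
  by apply: within_factorM uv (within_factorM _ (within_factorV _)).
split => [i j|i|i] /=; rewrite !mxE //; [|exact: step..].
(* The new product is [z_i * w_(j+1)] times a positive quotient, so it stays negative. *)
by rewrite mulrACA nmulr_rlt0 // mulr_gt0 // divr_gt0.
Qed.

Lemma tracks_iter p q m : tracks 1 p q ->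
  tracks (4 `^ ((5 ^+ m - 1) / 4)) (iter m (@pentagram R n) p)
    (iter m (@automaton R n) q).
Proof.
move=> pq; elim: m => [|m IH]; first by rewrite expr0 subrr mul0r powRr0.
rewrite !iterS.
(* The exponent [e_m = (5^m - 1) / 4] solves [e_0 = 0], [e_(m+1) = 1 + 5 * e_m]. *)
have -> : (4 : R) `^ ((5 ^+ m.+1 - 1) / 4) =
    4 * (4 `^ ((5 ^+ m - 1) / 4)) ^+ 5.
  rewrite -powR_mulrn ?powR_ge0 // -powRrM -[X in _ = X * _]powRr1 //.
  rewrite -powRD ?pnatr_eq0 ?implybT //; congr (_ `^ _).
  by rewrite exprS; field.
apply: tracks_step => //.
rewrite -[leLHS](powRr0 4) ler_powR ?ler1n //.
by rewrite divr_ge0 // subr_ge0 exprn_ege1 // ler1n.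
Qed.

Lemma tracks_exp_point q (p := exp_point t q) :
  tracks 1 (- p.1, p.2) q /\ tracks 1 (p.1, - p.2) q.
Proof.
by split; split => [i j|i|i] /=; rewrite !mxE ?mulNr ?mulrN ?oppr_lt0
  ?mulr_gt0 // ?normrN gtr0_norm //; split; rewrite ?mul1r.
Qed.

End Tropicalization.

Lemma quasi_per_tracks (R : realType) n k (p : coords R n) : quasi_per k p ->
  exists t q, [/\ 1 < t, automaton_per k q & tracks t 1 p q].
Proof.
move=> [] [_ [t t1 [q qk <-]] <-]; exists t, q; split => //;
  by case: (tracks_exp_point t1 q).
Qed.

(** Dividing the two comparisons cancels [v] and leaves [|u / u'|] within a factor [D] of 1. This
    relation is two-sided, which settles both exponents. *)
Lemma within_factor_ratio (R : realType) (D u v u' : R) (e : int) :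
  e = 1 \/ e = -1 ->
  within_factor 1 `|u| v -> within_factor D `|u'| v ->
  0 < `|u / u'| ^ e <= D.
Proof.
move=> he uv uv'.
have [_ v0 _ _] := uv.
have [] := within_factorM uv (within_factorV uv').
rewrite mul1r divff ?gt_eqF // mulr1 -normfV -normrM => r0 _ rD Dr.
case: he => ->; first by rewrite expr1z r0.
by rewrite exprN1 invr_gt0 r0 -div1r ler_pdivrMr.
Qed.

Theorem theorem2p2 (R : realType) (n k : nat) (hn : (1 <= n)%N) (hk : (1 <= k)%N)
    (p : coords R n) (hp : quasi_per k p) :
  (forall m : nat, pentagram_defined (iter m (@pentagram R n) p)) /\
  (forall (i : 'I_n) (e : int), e = 1 \/ e = -1 ->
     let q := iter k (@pentagram R n) p in
     0 < `|p.1 0 i / q.1 0 i| ^ e <= (4 : R) `^ ((5 ^+ k - 1) / 4) /\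
     0 < `|p.2 0 i / q.2 0 i| ^ e <= (4 : R) `^ ((5 ^+ k - 1) / 4)).
Proof.
have [t [q [t1 qk pq]]] := quasi_per_tracks hp.
split => [m|i e he].
  exact: tracks_pentagram_defined (tracks_iter t1 m pq).
have [_ hz hw] := tracks_iter t1 k pq; have [_ hz0 hw0] := pq.
(* Periodicity enters here: [p] and its [k]-th iterate are now compared with the same powers of
   [t]. *)
rewrite qk in hz hw.
by split; [apply: within_factor_ratio (hz0 i) (hz i)
          |apply: within_factor_ratio (hw0 i) (hw i)].
Qed.
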